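(* Let $\alpha>0$ and let $f:\mathbb{R}_{+}\rightarrow\mathbb{R}$ be an $\alpha$-strongly convex function such that $f(0)\leq 0$. Then \[ f(x+y+z)+f(z)\geq f(x+z)+f(y+z)+\alpha xy \] for all $x,y,z\geq 0$.
   Context: $\mathbb{R}_{+}=[0,\infty)$. A real-valued function $\Phi$ defined on a convex subset $C$ of $\mathbb{R}^{N}$ is called $\alpha$-strongly convex (with $\alpha>0$) if $\Phi-(\alpha/2)\|\cdot\|^{2}$ is convex, that is, $\Phi((1-\lambda)\mathbf{x}+\lambda\mathbf{y})\leq(1-\lambda)\Phi(\mathbf{x})+\lambda\Phi(\mathbf{y})-\frac{1}{2}\lambda(1-\lambda)\alpha\|\mathbf{x}-\mathbf{y}\|^{2}$ for all $\mathbf{x},\mathbf{y}\in C$ and $\lambda\in(0,1)$. Here $N=1$ and $C=\mathbb{R}_{+}$. *)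

(* Defs.v *)
From mathcomp Require Import all_boot all_order all_algebra.
From mathcomp Require Import interval_inference mathcomp_extra boolp.
From mathcomp Require Import classical_sets set_interval reals convex.
From mathcomp Require Import ring lra.

Set Implicit Arguments.
Unset Strict Implicit.
Unset Printing Implicit Defensive.

Import Order.TTheory GRing.Theory Num.Theory.

Local Open Scope classical_set_scope.
Local Open Scope ring_scope.

(* A function on a convex subset C of the line is represented by a total function
   f : R -> R, of which only the values on C are constrained. *)
Definition strongly_convex (R : realType) (alpha : R) (C : set R)
    (f : R -> R) : Prop :=
  @convex_function R R^o C (fun x : R => f x - (alpha / 2) * `|x| ^+ 2).

(* The weights of the library's convex combinations are in the order
   x <| t |> y = t * x + (1 - t) * y, and t ranges over the closed unit
   interval; the usual inequality is recovered as follows. *)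
Lemma strongly_convexP (R : realType) (alpha : R) (C : set R) (f : R -> R) :
  strongly_convex alpha C f <->
  forall x y l : R, C x -> C y -> 0 < l -> l < 1 ->
    f ((1 - l) * x + l * y) <=
    (1 - l) * f x + l * f y - 2^-1 * l * (1 - l) * alpha * `|x - y| ^+ 2.
Proof.
have key (x y l : R) :
    (f ((1 - l) * x + l * y) <=
      (1 - l) * f x + l * f y - 2^-1 * l * (1 - l) * alpha * `|x - y| ^+ 2) =
    (f (l * y + (1 - l) * x) - alpha / 2 * `|l * y + (1 - l) * x| ^+ 2 <=
      l * (f y - alpha / 2 * `|y| ^+ 2)
      + (1 - l) * (f x - alpha / 2 * `|x| ^+ 2)).
  rewrite !real_normK ?num_real// [l * y + _]addrC.
  rewrite -subr_ge0 -[RHS]subr_ge0; congr (_ <= _).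
  by move: (f ((1 - l) * x + l * y)) (f x) (f y) => a b c; field.
split=> [cf x y l Cx Cy l0 l1|cf t y x /set_mem Cy /set_mem Cx].
  rewrite key.
  exact: (cf (Itv01 (ltW l0) (ltW l1)) y x (mem_set Cy) (mem_set Cx)).
have [->|t0] := eqVneq t 0%:i01; first by rewrite !conv0.
have [->|t1] := eqVneq t 1%:i01; first by rewrite !conv1.
have := cf x y t%:num Cx Cy; rewrite key; apply.
  by rewrite lt_neqAle eq_sym t0 ge0.
by rewrite lt_neqAle t1 le1.
Qed.

(* Main.v *)
(* Both x + z and y + z are convex combinations of z and x + y + z, with
   complementary weights l = x / (x + y) and 1 - l. Adding the two strong
   convexity inequalities gives the result, as l (1 - l) (x + y)^2 = x y. *)
Require Import Defs.
From mathcomp Require Import all_boot all_order all_algebra.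
From mathcomp Require Import classical_sets set_interval reals.
From mathcomp Require Import ring.

Import Order.TTheory GRing.Theory Num.Theory.
Local Open Scope classical_set_scope.
Local Open Scope ring_scope.

Theorem proposition1 (R : realType) (alpha : R) (f : R -> R) :
  0 < alpha ->
  strongly_convex alpha `[0, +oo[%classic f ->
  f 0 <= 0 ->
  forall x y z : R, 0 <= x -> 0 <= y -> 0 <= z ->
    f (x + y + z) + f z >= f (x + z) + f (y + z) + alpha * x * y.
Proof.
move=> _ /strongly_convexP cf _ x y z x0 y0 z0.
(* If [x] or [y] is 0, both sides agree. Otherwise the weights lie strictly between 0 and 1, as
   [strongly_convexP] requires. *)
have [->|xn0] := eqVneq x 0; first by rewrite !add0r mulr0 mul0r addr0 addrC.
have [->|yn0] := eqVneq y 0; first by rewrite !(addr0, add0r) mulr0 addr0.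
have {xn0}x0 : 0 < x by rewrite lt_neqAle eq_sym xn0.
have {yn0}y0 : 0 < y by rewrite lt_neqAle eq_sym yn0.
have sn0 : x + y != 0 by rewrite gt_eqF// addr_gt0.
have Cz : `[0, +oo[%classic z by rewrite /= in_itv /= z0.
have Cs : `[0, +oo[%classic (x + y + z).
  by rewrite /= in_itv /= andbT !addr_ge0// ltW.
(* The condition on [u + v] keeps the endpoint [x + y + z] fixed when [x] and [y] are swapped. *)
have comb u v : 0 < u -> 0 < v -> u + v = x + y ->
    f (u + z) <= v / (u + v) * f z + u / (u + v) * f (x + y + z)
      - 2^-1 * alpha * u * v.
  move=> u0 v0 uv; have s0 : 0 < u + v by exact: addr_gt0.
  have un0 : u + v != 0 by rewrite gt_eqF.
  have := cf z (x + y + z) (u / (u + v)) Cz Cs.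
  rewrite -uv real_normK ?num_real// divr_gt0// ltr_pdivrMr// mul1r ltrDl v0.
  move=> /(_ isT isT).
  have -> : (1 - u / (u + v)) * z + u / (u + v) * (u + v + z) = u + z by field.
  move: (f z) (f (u + v + z)) (f (u + z)) => a b c.
  by congr (_ <= _); field.
have hxy := lerD (comb x y x0 y0 erefl) (comb y x y0 x0 (addrC y x)).
rewrite -lerBrDr; apply: le_trans hxy _; rewrite [y + x]addrC.
(* Equality holds here: the weights at each endpoint sum to 1, and the two halves of [alpha * x * y]
   add up. *)
rewrite le_eqVlt; apply/orP; left; apply/eqP.
by move: (f z) (f (x + y + z)) => a b; field.
Qed.
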